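(* Let $K$ be a positive integer, let $p$ be a prime number, and let $\varepsilon$ and $\kappa$ be positive real numbers with $\kappa<1$. For $k=1,\ldots,K$, let $\{a_{k,n}\}_{n=1}^\infty$ and $\{b_{k,n}\}_{n=1}^\infty$ be sequences of non-zero integers with $p\nmid\gcd(a_{k,n},b_{k,n})$, and set $a_{0,n}=1$ for all $n$. Suppose that for each $k=1,\ldots,K$: for each sufficiently large $N$ there is exactly one $n\le N$ with $\nu_p(a_{k,n})=\max_{1\le m\le N}\nu_p(a_{k,m})$, and \[\lim_{N\to\infty}\frac{\max_{1\le n\le N}\nu_p(a_{k,n})}{1+\max_{1\le n\le N}\nu_p(a_{k-1,n})}=\infty.\] Suppose there is a non-decreasing sequence $\{a_n\}_{n=1}^\infty$ of positive integers and an integer $A_0$ such that for each $k=1,\ldots,K$, each integer $A\ge A_0$ and all sufficiently large $n$: \[ n^{1+\varepsilon}\le a_n\le a_{n+1},\qquad |b_{k,n}|\le 2^{(\log_2 a_n)^\kappa},\] \[ a_n2^{-(\log_2 a_n)^\kappa}\le |a_{k,n}|\le \max\big\{a_n2^{(\log_2 a_n)^\kappa},\,2^{A^n}\big\},\] and for each integer $A\ge A_0$, $\limsup_{n\to\infty}a_n^{1/A^n}=\infty$. For $k=1,\ldots,K$ set $\alpha_k=\sum_{n=1}^\infty\frac{b_{k,n}}{a_{k,n}}$. Then $\alpha_1,\ldots,\alpha_K$ are algebraically independent over $\mathbb Q$.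
   Context: For a prime $p$ and integer $n$, $\nu_p(n)$ denotes the $p$-adic valuation of $n$ (with $\nu_p(0)=\infty$). *)

(* Defs.v *)
From Stdlib Require Import Reals ZArith.
From mathcomp Require Import all_boot all_algebra.
From mathcomp Require Import Rstruct.
From mathcomp Require Import mpoly.

Set Implicit Arguments.
Unset Strict Implicit.
Unset Printing Implicit Defensive.

Definition nu (p : nat) (z : Z) : nat := logn p (Z.abs_nat z).

Definition maxnu (p : nat) (a : nat -> Z) (N : nat) : nat :=
  \max_(1 <= m < N.+1) nu p (a m).

Local Open Scope R_scope.
Definition log2 (x : R) : R := ln x / ln 2.

Local Close Scope R_scope.
Definition alg_indep (K : nat) (x : 'I_K -> R) : Prop :=
  forall P : {mpoly rat[K]}, P != 0%R ->
    (map_mpoly (ratr : rat -> R) P).@[x] <> 0%R.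

(* Main.v *)
Require Import Defs.
From Stdlib Require Import Reals ZArith Lra Lia.
From mathcomp Require Import all_boot all_order all_algebra.
From mathcomp Require Import Rstruct.
From mathcomp Require Import mpoly.
From mathcomp Require Import zify ssrZ.

(** Let [x N] be the vector of the [N]-th partial sums and suppose [P alpha = 0]
    with [P != 0] over the rationals.  The uniqueness of the maximal p-adic
    valuation gives [x N k] the valuation [- max_(n <= N) nu_p (a k n)], and since
    these maxima grow faster and faster in [k], the monomials of [P] take pairwise
    distinct valuations at [x N]; hence [P (x N) != 0] for large [N], and [|P (x N)|]
    is at least the inverse of a fixed power of the product of all denominators.
    On the other hand [|P (x N)| = |P (x N) - P alpha|] is at most a constant times
    [a_(N+1) ^ (- eta)].  With [L n = log2 a_n] the two bounds combine to
    [L (N+1) <= D (1 + \sum_(n <= N) (2 L n + A ^ n))] for all large [N], which forces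
    [L n = O(B ^ n)] for some [B] and contradicts the limsup hypothesis for [B]. *)

Import Order.TTheory GRing.Theory Num.Theory.

(** * p-adic valuations of rationals *)

Section PadicValuation.
Local Open Scope ring_scope.

(** The numerator [z] may be divisible by [p] or even zero, so [0] satisfies every lower bound and
    no infinite value has to be introduced. *)
Definition pval_ge (p : nat) (e : int) (q : rat) : Prop :=
  exists z s : int, ~~ (p %| s)%Z /\ q = p%:R ^ e * (z%:~R / s%:~R).

Definition pval_eq (p : nat) (e : int) (q : rat) : Prop :=
  exists z s : int, [/\ ~~ (p %| z)%Z, ~~ (p %| s)%Z &
    q = p%:R ^ e * (z%:~R / s%:~R)].

Lemma prime_rat_neq0 p : prime p -> p%:R != 0 :> rat.
Proof. by move=> pp; rewrite pnatr_eq0 -lt0n prime_gt0. Qed.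

Lemma ndvdz_rat_neq0 (p : nat) (s : int) : ~~ (p %| s)%Z -> s%:~R != 0 :> rat.
Proof. by rewrite intr_eq0; apply: contraNneq => ->; rewrite dvdz0. Qed.

Lemma ndvdzM (p : nat) (s t : int) : prime p ->
  ~~ (p %| s)%Z -> ~~ (p %| t)%Z -> ~~ (p %| s * t)%Z.
Proof. by move=> pp; rewrite !dvdzE abszM Euclid_dvdM // negb_or => -> ->. Qed.

Lemma pval_eq_ge p e q : pval_eq p e q -> pval_ge p e q.
Proof. by case=> z [s [_ hs ->]]; exists z, s. Qed.

Lemma pval_ge0 p e : prime p -> pval_ge p e 0.
Proof.
move=> pp; exists 0, 1; rewrite mul0r mulr0; split=> //.
by rewrite dvdzE /= dvdn1 neq_ltn prime_gt1 // orbT.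
Qed.

Lemma pval_eq1 p : prime p -> pval_eq p 0 1.
Proof.
move=> pp; exists 1, 1; split=> //;
by rewrite dvdzE /= dvdn1 neq_ltn prime_gt1 // orbT.
Qed.

Lemma pval_ge_le p e e' q : prime p -> e' <= e -> pval_ge p e q -> pval_ge p e' q.
Proof.
move=> pp le_e [z [s [hs ->]]].
have [n ->] : exists n : nat, e = e' + n%:Z.
  by exists `|e - e'|%N; rewrite gez0_abs ?subr_ge0 // subrKC.
exists (p%:Z ^+ n * z), s; split=> //.
by rewrite expfzDr ?prime_rat_neq0 // rmorphM rmorphXn /= -!mulrA.
Qed.

Lemma pval_geD p e x y : prime p ->
  pval_ge p e x -> pval_ge p e y -> pval_ge p e (x + y).
Proof.
move=> pp [z [s [hs ->]]] [z' [s' [hs' ->]]].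
exists (z * s' + z' * s), (s * s'); split; first exact: ndvdzM.
by rewrite -mulrDr addf_div ?(ndvdz_rat_neq0 p) // rmorphD !rmorphM.
Qed.

(** Strict ultrametric case. Once [e'] is lowered to [e + 1], the numerator of the sum is
    [z * s' + p * z' * s]: the first summand is prime to [p] and the second is divisible by [p]. *)
Lemma pval_eqDl p e e' x y : prime p -> e < e' ->
  pval_eq p e x -> pval_ge p e' y -> pval_eq p e (x + y).
Proof.
move=> pp lt_e [z [s [hz hs ->]]] hy.
have {hy} [z' [s' [hs' ->]]] : pval_ge p (e + 1) y.
  by apply: pval_ge_le hy => //; rewrite lezD1.
exists (z * s' + p%:Z * z' * s), (s * s'); split; last 2 first.
- exact: ndvdzM.
- rewrite expfzDr ?prime_rat_neq0 // expr1z.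
  rewrite -[_ * p%:R * _]mulrA -mulrDr; congr (_ * _).
  rewrite mulrA addf_div ?(ndvdz_rat_neq0 p) //.
  by rewrite rmorphD !rmorphM.
rewrite rpredDr ?ndvdzM //.
by rewrite -mulrA dvdz_mulr // dvdzz.
Qed.

Lemma pval_eqM p e e' x y : prime p ->
  pval_eq p e x -> pval_eq p e' y -> pval_eq p (e + e') (x * y).
Proof.
move=> pp [z [s [hz hs ->]]] [z' [s' [hz' hs' ->]]].
exists (z * z'), (s * s'); split; [exact: ndvdzM | exact: ndvdzM |].
by rewrite expfzDr ?prime_rat_neq0 // !rmorphM /= -mulf_div mulrACA.
Qed.

Lemma pval_eqV p e x : pval_eq p e x -> pval_eq p (- e) x^-1.
Proof.
case=> z [s [hz hs ->]]; exists s, z; split=> //.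
by rewrite invfM invf_div -invr_expz.
Qed.

Lemma pval_eqX p e x n : prime p -> pval_eq p e x -> pval_eq p (e *+ n) (x ^+ n).
Proof.
move=> pp hx; elim: n => [|n IHn]; first by rewrite expr0 mulr0n; apply: pval_eq1.
by rewrite exprS mulrS; apply: pval_eqM.
Qed.

Lemma pval_eq_prod p (I : finType) (e : I -> int) (x : I -> rat) : prime p ->
  (forall i, pval_eq p (e i) (x i)) -> pval_eq p (\sum_i e i) (\prod_i x i).
Proof.
move=> pp hx; apply: (big_ind2 (fun x y => pval_eq p y x)) => //.
- exact: pval_eq1.
- by move=> ? ? ? ?; apply: pval_eqM.
Qed.

Lemma pval_eq_neq0 p e x : prime p -> pval_eq p e x -> x != 0.
Proof.
move=> pp [z [s [hz hs ->]]].
by rewrite !mulf_neq0 ?invr_eq0 ?expfz_neq0 ?prime_rat_neq0 ?(ndvdz_rat_neq0 p).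
Qed.

Lemma pval_eq_int p (z : int) : prime p -> z != 0 ->
  pval_eq p (logn p `|z|)%:Z z%:~R.
Proof.
move=> pp z0; have [m hm hz] : {m | coprime p m & `|z|%N = (m * p ^ logn p `|z|)%N}.
  by apply: pfactor_coprime; rewrite ?absz_gt0.
exists ((-1) ^+ (z < 0)%R * m%:Z), 1; split.
- by rewrite dvdzE abszMsign /= -prime_coprime.
- by rewrite dvdzE /= dvdn1 neq_ltn prime_gt1 // orbT.
rewrite divr1 -exprnP {1}(intEsign z) {1}hz PoszM mulrA rmorphM mulrC; congr (_ * _).
by rewrite -natrX.
Qed.

(** At [q = 0] this takes the default value 0, so it is a true valuation only for non-zero [q]. *)
Definition pval (p : nat) (q : rat) : int :=
  (logn p `|numq q|)%:Z - (logn p `|denq q|)%:Z.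

Lemma pval_eq_pval p q : prime p -> q != 0 -> pval_eq p (pval p q) q.
Proof.
move=> pp q0; rewrite -[X in pval_eq _ _ X]divq_num_den; apply: pval_eqM => //.
  by apply: pval_eq_int; rewrite // numq_eq0.
by apply/pval_eqV/pval_eq_int; rewrite // denq_eq0.
Qed.

Lemma pval_ge_sum p e (I : eqType) (r : seq I) (t : I -> rat) : prime p ->
  (forall i, i \in r -> pval_ge p e (t i)) -> pval_ge p e (\sum_(i <- r) t i).
Proof.
move=> pp ht; rewrite big_seq; apply: big_ind => //; first exact: pval_ge0.
by move=> ? ?; apply: pval_geD.
Qed.

(** By induction the tail sum has the valuation of one of its terms. Injectivity separates that
    value from the valuation of the head, so the smaller of the two survives the addition. *)
Lemma pval_eq_sum_injective p (I : eqType) (r : seq I) (t : I -> rat) (e : I -> int) :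
  prime p -> uniq r -> r != [::] ->
  (forall i, i \in r -> pval_eq p (e i) (t i)) ->
  {in r &, injective e} ->
  exists2 j, j \in r & pval_eq p (e j) (\sum_(i <- r) t i).
Proof.
move=> pp; elim: r => // i r IHr /= /andP [ir ur] _ ht inje.
have hi : pval_eq p (e i) (t i) by apply: ht; rewrite mem_head.
case: (eqVneq r [::]) => [->|r0].
  by exists i; rewrite ?mem_head // big_seq1.
have [|x y hx hy|j jr hj] := IHr ur r0.
- by move=> j jr; apply: ht; rewrite inE jr orbT.
- by apply: inje; rewrite inE ?hx ?hy orbT.
rewrite big_cons; case: (ltgtP (e i) (e j)) => h.
- exists i; rewrite ?mem_head //.
  by apply: pval_eqDl h _ _ => //; apply: pval_eq_ge.
- exists j; first by rewrite inE jr orbT.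
  by rewrite addrC; apply: pval_eqDl h _ _ => //; apply: pval_eq_ge.
- have /inje : e i = e j by [].
  rewrite mem_head inE jr orbT => /(_ isT isT) eij.
  by rewrite eij jr in ir.
Qed.

End PadicValuation.

(** * Values of polynomials: a lower bound at rational points and a Lipschitz bound *)

Section Polynomial.
Local Open Scope ring_scope.

Lemma mexponent_bound (K : nat) (R : nzRingType) (P : {mpoly R[K]}) (m : 'X_{1..K}) (i : 'I_K) :
  m \in msupp P -> (m i <= msize P)%N.
Proof.
move=> hm; have := msize_mdeg_lt hm => /ltnW; apply: leq_trans.
by rewrite mdegE (bigD1 i) //= leq_addr.
Qed.

Lemma meval_map_ratr (K : nat) (F : numFieldType) (P : {mpoly rat[K]}) (x : 'I_K -> rat) :
  (map_mpoly (ratr : rat -> F) P).@[fun i => ratr (x i)] = ratr P.@[x].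
Proof.
rewrite !mevalE (perm_big _ (msupp_map_mpoly _ (fmorph_inj (ratr : rat -> F)))) /=.
rewrite rmorph_sum; apply: eq_bigr => m _.
rewrite mcoeff_map_mpoly rmorphM rmorph_prod; congr (_ * _).
by apply: eq_bigr => i _; rewrite rmorphXn.
Qed.

(** The product [c] of the coefficient denominators and the powers of the [D i] clear every
    denominator of [P.@[x]], and a non-zero integer has absolute value at least 1. *)
Lemma meval_rat_lower_bound (K : nat) (P : {mpoly rat[K]}) :
  exists2 c : rat, 0 < c & forall x D : 'I_K -> rat,
    (forall i, D i \is a Num.int) -> (forall i, x i * D i \is a Num.int) ->
    (forall i, D i != 0) -> P.@[x] != 0 ->
    1 <= `|P.@[x]| * (c * \prod_i `|D i| ^+ msize P).
Proof.
pose c : rat := \prod_(m <- msupp P) (denq P@_m)%:~R.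
have c0 : 0 < c by apply: prodr_gt0 => m _; rewrite ltr0z denq_gt0.
exists c => // x D Dint xDint D0 Px0.
pose W := \prod_i D i ^+ msize P.
have W0 : W != 0 by apply/prodf_neq0 => i _; rewrite expf_neq0.
have -> : \prod_i `|D i| ^+ msize P = `|W|.
  by rewrite normr_prod; apply: eq_bigr => i _; rewrite normrX.
rewrite -(gtr0_norm c0) -!normrM norm_intr_ge1 ?mulf_neq0 ?(gt_eqF c0) //.
rewrite mevalE mulr_suml big_seq rpred_sum // => m hm.
rewrite mulrACA rpredM //.
  rewrite /c (big_rem m hm) /= mulrA rpredM //.
    by rewrite -[X in X * _]divq_num_den divfK ?intr_eq0 ?denq_eq0 ?intr_int.
  by rewrite rpred_prod // => m' _; rewrite intr_int.
(* Each exponent [m i] is at most [msize P], so [m i] factors [D i] can be paired with the factors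
   [x i]; the remaining power of [D i] is an integer. *)
rewrite /W -big_split rpred_prod //= => i _.
rewrite -(subnKC (mexponent_bound _ _ _ _ i hm)) exprD mulrA -exprMn.
by rewrite rpredM ?rpredX.
Qed.

(** On the box of radius [B], the functions that are both bounded and Lipschitz form a class closed
    under sums and products; boundedness enters through the product rule. Constants and coordinates
    lie in this class, hence so does [P]. *)
Lemma meval_lipschitz (K : nat) (F : realFieldType) (P : {mpoly F[K]}) (B : F) :
  exists2 C : F, 0 < C & forall (x y : 'I_K -> F) (d : F),
    (forall i, `|x i| <= B) -> (forall i, `|y i| <= B) ->
    (forall i, `|x i - y i| <= d) -> 0 <= d -> `|P.@[x] - P.@[y]| <= C * d.
Proof.
pose lip (f : ('I_K -> F) -> F) := exists2 C : F, 0 < C &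
  forall (x y : 'I_K -> F) (d : F),
    (forall i, `|x i| <= B) -> (forall i, `|y i| <= B) ->
    (forall i, `|x i - y i| <= d) -> 0 <= d ->
    [/\ `|f x| <= C, `|f y| <= C & `|f x - f y| <= C * d].
have lipC c : lip (fun=> c).
  exists (`|c| + 1) => [|x y d _ _ _ d0]; first by rewrite ltr_wpDl.
  by rewrite subrr normr0 !lerDl ler01 mulr_ge0 // addr_ge0.
have lipX i : lip (fun x => x i).
  exists (`|B| + 1) => [|x y d hx hy hxy d0]; first by rewrite ltr_wpDl.
  have B1 : B <= `|B| + 1 by rewrite (le_trans (ler_norm _)) ?lerDl.
  split; [exact: le_trans (hx i) B1 | exact: le_trans (hy i) B1 |].
  by apply: le_trans (hxy i) _; rewrite ler_peMl // lerDr.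
have lipD f g : lip f -> lip g -> lip (fun x => f x + g x).
  move=> [Cf Cf0 hf] [Cg Cg0 hg]; exists (Cf + Cg); first exact: addr_gt0.
  move=> x y d hx hy hxy d0.
  have [f1 f2 f3] := hf x y d hx hy hxy d0; have [g1 g2 g3] := hg x y d hx hy hxy d0.
  split; try by rewrite (le_trans (ler_normD _ _)) ?lerD.
  by rewrite opprD addrACA mulrDl (le_trans (ler_normD _ _)) ?lerD.
have lipM f g : lip f -> lip g -> lip (fun x => f x * g x).
  move=> [Cf Cf0 hf] [Cg Cg0 hg]; exists (Cf * Cg *+ 2).
    by rewrite pmulrn_lgt0 // mulr_gt0.
  move=> x y d hx hy hxy d0.
  have [f1 f2 f3] := hf x y d hx hy hxy d0; have [g1 g2 g3] := hg x y d hx hy hxy d0.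
  have fg0 : 0 <= Cf * Cg by rewrite mulr_ge0 ?ltW.
  split.
  - by rewrite normrM mulr2n ler_wpDr // ler_pM.
  - by rewrite normrM mulr2n ler_wpDr // ler_pM.
  - have -> : f x * g x - f y * g y = (f x - f y) * g x + f y * (g x - g y).
      by rewrite mulrBl mulrBr addrA subrK.
    rewrite (le_trans (ler_normD _ _)) // !normrM mulr2n mulrDl lerD //.
      by rewrite mulrAC ler_pM.
    by rewrite -mulrA ler_pM.
have lip_ext f g : f =1 g -> lip f -> lip g.
  by move=> fg [C C0 hf]; exists C => // x y d hx hy hxy d0; rewrite -!fg; apply: hf.
have lip_sum (r : seq 'X_{1..K}) (h : 'X_{1..K} -> ('I_K -> F) -> F) :
    (forall m, lip (h m)) -> lip (fun x => \sum_(m <- r) h m x).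
  move=> hh; elim: r => [|m r IHr].
    by apply: (lip_ext (fun=> 0)) => // x; rewrite big_nil.
  apply: (lip_ext (fun x => h m x + \sum_(m <- r) h m x)).
    by move=> x; rewrite big_cons.
  exact: lipD.
have lip_prod (r : seq 'I_K) (h : 'I_K -> ('I_K -> F) -> F) :
    (forall m, lip (h m)) -> lip (fun x => \prod_(m <- r) h m x).
  move=> hh; elim: r => [|m r IHr].
    by apply: (lip_ext (fun=> 1)) => // x; rewrite big_nil.
  apply: (lip_ext (fun x => h m x * \prod_(m <- r) h m x)).
    by move=> x; rewrite big_cons.
  exact: lipM.
have lip_exp i n : lip (fun x => x i ^+ n).
  elim: n => [|n IHn]; first exact: (lip_ext (fun=> 1)).
  apply: (lip_ext (fun x => x i * x i ^+ n)) => [x|]; first by rewrite exprS.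
  exact: lipM.
have [C C0 hC] : lip (fun x => P.@[x]).
  apply: (lip_ext (fun x => \sum_(m <- msupp P) P@_m * \prod_i x i ^+ m i)).
    by move=> x; rewrite mevalE.
  by apply: lip_sum => m; apply: lipM => //; apply: lip_prod.
by exists C => // x y d hx hy hxy d0; have [] := hC x y d hx hy hxy d0.
Qed.

End Polynomial.

(** * Non-vanishing at points whose valuations are widely separated *)

Section NonVanishing.
Local Open Scope ring_scope.

(* Comparing at the largest index where the exponents differ, a single extra factor
   outweighs all smaller weights and the valuations of the coefficients together. *)
Lemma weight_gap (K d C M : nat) (V : nat -> nat) (m m' : 'I_K -> nat) (j : 'I_K) :
  (K * d + C < M)%N -> (forall k, (k < K)%N -> (M * (1 + V k) <= V k.+1)%N) ->
  (forall i, (m i <= d)%N) -> (m j < m' j)%N ->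
  (forall i : 'I_K, (j < i)%N -> m i = m' i) ->
  (\sum_(i < K) V i.+1 * m i + C < \sum_(i < K) V i.+1 * m' i)%N.
Proof.
move=> hM hV hd hj htop.
have M0 : (0 < M)%N by exact: leq_ltn_trans (leq0n _) hM.
have Vmono k l : (k <= l)%N -> (l <= K)%N -> (V k <= V l)%N.
  elim: l => [|l IHl]; first by rewrite leqn0 => /eqP ->.
  rewrite leq_eqVlt => /orP [/eqP -> //|kl lK].
  apply: leq_trans (IHl kl (ltnW lK)) _; apply: leq_trans (hV l lK).
  by rewrite (leq_trans _ (leq_pmull _ M0)) // leq_addl.
rewrite (bigD1 j) //= [X in (_ < X)%N](bigD1 j) //=.
have hrest : (\sum_(i < K | i != j) V i.+1 * m i <=
              \sum_(i < K | i != j) V i.+1 * m' i + K * (d * V j))%N.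
  apply: (@leq_trans (\sum_(i < K | i != j) (V i.+1 * m' i + d * V j))%N).
    apply: leq_sum => i ij; case: (ltngtP i j) => hij.
    - by rewrite mulnC (leq_trans _ (leq_addl _ _)) // leq_mul // Vmono // ltnW.
    - by rewrite htop // leq_addr.
    - by move/val_inj: hij ij => ->; rewrite eqxx.
  rewrite big_split leq_add2l sum_nat_const leq_mul2r.
  by rewrite (leq_trans (max_card _)) ?card_ord ?orbT.
have h1 : (V j.+1 * m j + V j.+1 <= V j.+1 * m' j)%N by rewrite addnC -mulnS leq_mul2l hj orbT.
have h2 := hV j (ltn_ord j).
have h3 : (K * (d * V j) + C < M * (1 + V j))%N.
  rewrite mulnDr muln1 mulnA.
  have : (K * d * V j <= M * V j)%N by rewrite leq_mul2r; apply/orP; right; lia.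
  lia.
move: hrest h1 h2 h3; move: (\sum_(i < K | _) _)%N (\sum_(i < K | _) _)%N => S S'.
lia.
Qed.

(** The monomial [m] takes the valuation [pval p P@_m - \sum_i V i.+1 * m i] at [x]. The rapid
    growth of [V] makes these values pairwise distinct, so no cancellation can produce 0. *)
Lemma meval_neq0_of_pval (K p : nat) (P : {mpoly rat[K]}) : prime p -> P != 0 ->
  exists M : nat, forall (V : nat -> nat) (x : 'I_K -> rat),
    (forall k, (k < K)%N -> (M * (1 + V k) <= V k.+1)%N) ->
    (forall i : 'I_K, pval_eq p (- (V i.+1)%:Z) (x i)) -> P.@[x] != 0.
Proof.
move=> pp P0.
pose C := (\max_(m <- msupp P) `|pval p P@_m|)%N.
have hC m : m \in msupp P -> (`|pval p P@_m| <= C)%N.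
  by move=> hm; apply: (@leq_bigmax_seq _ _ _ (fun m => `|pval p P@_m|%N)).
(* [msize P] bounds all exponents; [C] is counted twice because the coefficients of both compared
   monomials contribute. *)
exists (K * msize P + (C + C)).+1 => V x hV hx.
pose e (m : 'X_{1..K}) := pval p P@_m + \sum_(i < K) (- (V i.+1)%:Z) *+ m i.
have eE (m : 'X_{1..K}) : e m = pval p P@_m - (\sum_(i < K) V i.+1 * m i)%:Z.
  rewrite /e; congr (_ + _);
  under eq_bigr do rewrite mulNrn.
  rewrite sumrN; congr (- _); rewrite (big_morph Posz PoszD (erefl _)).
  by apply: eq_bigr => i _; rewrite -mulr_natr PoszM natz.
rewrite mevalE.
have [|m hm|m m' hm hm' eq_e|j _ hj] :=
  pval_eq_sum_injective p _ (msupp P) (fun m => P@_m * \prod_i x i ^+ m i) e pp (msupp_uniq P).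
- by rewrite msupp_eq0.
- apply: pval_eqM => //; first by apply: pval_eq_pval; rewrite // -mcoeff_msupp.
  by apply: pval_eq_prod => // i; apply: pval_eqX.
- apply/eqP; apply/negPn/negP => ne.
  have {ne} [i0 hi0] : exists i, m i != m' i.
    apply/existsP; rewrite -negb_forall; apply: contra ne => /forallP h.
    by apply/eqP/mnmP => i; apply/eqP.
  (* [j] is the largest index where [m] and [m'] differ, so the exponents above it agree, as
     [weight_gap] requires. *)
  case: (@arg_maxnP _ i0 (fun i => m i != m' i) (fun i => nat_of_ord i) hi0) => j jne jmax.
  have htop (i : 'I_K) : (j < i)%N -> m i = m' i.
    by move=> ji; apply/eqP/negPn/negP => /jmax; rewrite /geq /= leqNgt ji.
  have hb := hC _ hm; have hb' := hC _ hm'.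
  have hd i := mexponent_bound _ _ P m i hm.
  have hd' i := mexponent_bound _ _ P m' i hm'.
  move: eq_e; rewrite !eE.
  case: (ltngtP (m j) (m' j)) jne => // hj _.
  + have := weight_gap K (msize P) (C + C) _ V m m' j (ltnSn _) hV hd hj htop.
    by move: hb hb'; lia.
  + have := weight_gap K (msize P) (C + C) _ V m' m j (ltnSn _) hV hd' hj
      (fun i h => esym (htop i h)).
    by move: hb hb'; lia.
- exact: pval_eq_neq0 pp hj.
Qed.

Lemma absz_int_of_Z z : `|int_of_Z z|%N = Z.abs_nat z.
Proof. lia. Qed.

Definition ratZ (z : Z) : rat := (int_of_Z z)%:~R.

Lemma pval_eq_ratZ p z : prime p -> z <> Z0 -> pval_eq p (nu p z)%:Z (ratZ z).
Proof.
by move=> pp z0; rewrite /nu -absz_int_of_Z; apply: pval_eq_int => //; lia.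
Qed.

(** The term at the unique maximising index has valuation exactly [- maxnu p a N], and every other
    term has a strictly larger one, so that single term decides the sum. *)
Lemma pval_eq_partial_sum p (a b : nat -> Z) N : prime p ->
  (forall n, (1 <= n)%N -> a n <> Z0 /\ b n <> Z0 /\
     ~ Z.divide (Z.of_nat p) (Z.gcd (a n) (b n))) ->
  (exists! n, (1 <= n <= N)%N /\ nu p (a n) = maxnu p a N) ->
  (0 < maxnu p a N)%N ->
  pval_eq p (- (maxnu p a N)%:Z) (\sum_(1 <= n < N.+1) ratZ (b n) / ratZ (a n)).
Proof.
move=> pp hab [n [[hn nmax] nuniq]] max0.
have hterm m : (1 <= m)%N ->
    pval_eq p ((nu p (b m))%:Z - (nu p (a m))%:Z) (ratZ (b m) / ratZ (a m)).
  move=> /hab [a0 [b0 _]]; apply: pval_eqM => //; first exact: pval_eq_ratZ.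
  by apply/pval_eqV/pval_eq_ratZ.
have nin : n \in index_iota 1 N.+1 by rewrite mem_index_iota.
rewrite (bigD1_seq n) ?iota_uniq //=.
have n1 : (1 <= n)%N by case/andP: hn.
(* As the maximum is positive, [p] divides [a n]; the gcd condition then keeps [p] from dividing
   [b n]. *)
have b0 : nu p (b n) = 0%N.
  have [an0 [bn0 ng]] := hab n n1; apply/eqP; rewrite -leqn0 leqNgt; apply/negP => hb.
  have dvdp z : (0 < nu p z)%N -> Z.divide (Z.of_nat p) z.
    rewrite /nu logn_gt0 mem_primes => /and3P [_ _ /dvdnP [q hq]].
    apply/Z.divide_abs_r; exists (Z.of_nat q).
    by rewrite -Zabs2Nat.id_abs hq Nat2Z.inj_mul.
  by apply: ng; apply: Z.gcd_greatest; apply: dvdp => //; rewrite nmax.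
apply: (@pval_eqDl _ _ (- (maxnu p a N)%:Z + 1)) => //; first by rewrite ltrDl.
  by have := hterm n n1; rewrite b0 nmax add0r.
rewrite -big_filter; apply: pval_ge_sum => // m.
rewrite mem_filter mem_index_iota => /andP [mn hm].
have m1 : (1 <= m)%N by case/andP: hm.
apply: pval_ge_le (pval_eq_ge _ _ _ (hterm m m1)) => //.
have : (nu p (a m) < maxnu p a N)%N.
  rewrite ltn_neqAle; apply/andP; split.
    apply: contra mn => /eqP h; apply/eqP/esym/nuniq; split=> //.
  rewrite /maxnu; apply: (@leq_bigmax_seq _ _ _ (fun m => nu p (a m))) => //.
  by rewrite mem_index_iota.
lia.
Qed.

End NonVanishing.

(** * Series tails, base-2 logarithms and growth of recursive sequences *)

Section Analysis.
Local Open Scope R_scope.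

(** Division by [Rpower x (- s)] leaves [1 + s / x <= (1 - 1 / x) ^ (- s)], which follows from
    [ln (1 - 1 / x) <= - 1 / x] and [1 + t <= exp t]. *)
Lemma Rpower_telescope s x : 0 < s -> 1 < x ->
  s * Rpower x (- (1 + s)) <= Rpower (x - 1) (- s) - Rpower x (- s).
Proof.
move=> s0 x1.
have xm : 0 < x - 1 by lra.
have ix : 0 < / x by apply: Rinv_0_lt_compat; lra.
have y0 : 0 < (x - 1) * / x by apply: Rmult_lt_0_compat.
have -> : Rpower (x - 1) (- s) = Rpower x (- s) * Rpower ((x - 1) * / x) (- s).
  by rewrite Rpower_mult_distr; [congr Rpower; field; lra | lra | done].
have -> : Rpower x (- (1 + s)) = Rpower x (- s) * / x.
  by rewrite Ropp_plus_distr Rplus_comm Rpower_plus (Rpower_Ropp x 1) Rpower_1; lra.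
have X0 : 0 < Rpower x (- s) by apply: exp_pos.
suff : s * / x + 1 <= Rpower ((x - 1) * / x) (- s) by nra.
have hln : ln ((x - 1) * / x) <= - / x.
  have := exp_ineq1_le (ln ((x - 1) * / x)); rewrite exp_ln //.
  have -> : (x - 1) * / x = 1 - / x by field; lra.
  lra.
rewrite /Rpower; apply: Rle_trans (exp_ineq1_le _); nra.
Qed.

Lemma partial_sum_telescoping_bound (u g : nat -> R) N m :
  (forall n, (N < n)%N -> Rabs (u n) <= g n - g n.+1) ->
  (forall n, (N < n)%N -> 0 <= g n) ->
  sum_f_R0 (fun n => Rabs (u n)) (N + m) - sum_f_R0 (fun n => Rabs (u n)) N <= g N.+1.
Proof.
move=> hu hg.
(* Keeping the term [- g (N + m).+1] makes the induction telescope. *)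
suff : sum_f_R0 (fun n => Rabs (u n)) (N + m) - sum_f_R0 (fun n => Rabs (u n)) N
       <= g N.+1 - g (N + m).+1 by have := hg (N + m).+1 ltac:(lia); lra.
elim: m => [|m IHm]; first by rewrite addn0; lra.
rewrite addnS /=; have := hu (N + m).+1 ltac:(lia); lra.
Qed.

Lemma infinite_sum_of_telescoping (u g : nat -> R) N :
  (forall n, (N < n)%N -> Rabs (u n) <= g n - g n.+1) ->
  (forall n, (N < n)%N -> 0 <= g n) -> {l | infinite_sum u l}.
Proof.
move=> hu hg.
apply: cv_cauchy_2; apply: cauchy_abs; apply: cv_cauchy_1.
have grow : Un_growing (sum_f_R0 (fun n => Rabs (u n))).
  by move=> n /=; have := Rabs_pos (u n.+1); lra.
apply: growing_cv => //.
exists (sum_f_R0 (fun n => Rabs (u n)) N + g N.+1) => _ [n ->].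
case: (leqP n N) => hn.
  have := growing_prop _ _ _ grow (ltac:(lia) : (N >= n)%coq_nat).
  have := hg N.+1 ltac:(lia); lra.
have := partial_sum_telescoping_bound u g N (n - N) hu hg.
rewrite subnKC; [lra | exact: ltnW].
Qed.

Lemma infinite_sum_tail_bound (u g : nat -> R) N l : infinite_sum u l ->
  (forall n, (N < n)%N -> Rabs (u n) <= g n - g n.+1) ->
  (forall n, (N < n)%N -> 0 <= g n) -> Rabs (sum_f_R0 u N - l) <= g N.+1.
Proof.
move=> hl hu hg; apply: le_epsilon => e e0.
have [M hM] := hl e e0.
have := hM (N + M)%N ltac:(lia); rewrite /Rdist => h.
have h1 := partial_sum_telescoping_bound u g N M hu hg.
have h2 : Rabs (sum_f_R0 u (N + M) - sum_f_R0 u N) <=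
    sum_f_R0 (fun n => Rabs (u n)) (N + M) - sum_f_R0 (fun n => Rabs (u n)) N.
  elim: M {hM h h1} => [|M IHM]; first by rewrite addn0 !Rminus_diag Rabs_R0; lra.
  rewrite addnS /=.
  have := Rabs_triang (sum_f_R0 u (N + M) - sum_f_R0 u N) (u (N + M).+1).
  have -> : sum_f_R0 u (N + M) - sum_f_R0 u N + u (N + M).+1 =
            sum_f_R0 u (N + M) + u (N + M).+1 - sum_f_R0 u N by ring.
  lra.
have := Rabs_triang (sum_f_R0 u N - sum_f_R0 u (N + M)) (sum_f_R0 u (N + M) - l).
rewrite (Rabs_minus_sym (sum_f_R0 u N)).
have -> : sum_f_R0 u N - sum_f_R0 u (N + M) + (sum_f_R0 u (N + M) - l) =
  sum_f_R0 u N - l by ring.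
lra.
Qed.

Lemma ln2_gt0 : 0 < ln 2.
Proof. by rewrite -ln_1; apply: ln_increasing; lra. Qed.

Lemma Rpower2_log2 x : 0 < x -> Rpower 2 (log2 x) = x.
Proof.
move=> x0; rewrite /Rpower /log2 /Rdiv Rmult_assoc Rinv_l ?Rmult_1_r ?exp_ln //.
by have := ln2_gt0; lra.
Qed.

Lemma log2_Rpower2 x : log2 (Rpower 2 x) = x.
Proof. by rewrite /log2 /Rpower ln_exp; field; have := ln2_gt0; lra. Qed.

Lemma log2_le x y : 0 < x -> x <= y -> log2 x <= log2 y.
Proof.
move=> x0 xy; apply: Rmult_le_compat_r.
  by apply/Rlt_le/Rinv_0_lt_compat/ln2_gt0.
case: xy => [xy|->]; last exact: Rle_refl.
exact/Rlt_le/ln_increasing.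
Qed.

Lemma log2_Rpower x y : log2 (Rpower x y) = y * log2 x.
Proof. by rewrite /log2 /Rpower ln_exp; field; have := ln2_gt0; lra. Qed.

Lemma log2_INR_ge0 n : 0 <= log2 (INR n).
Proof.
case: n => [|n]; last first.
  have -> : 0 = log2 1 by rewrite /log2 ln_1; lra.
  by apply: log2_le; [lra | rewrite S_INR; have := pos_INR n; lra].
(* [ln] has the default value 0 at 0. This case matters because the sum [T] in the final proof
   includes [an 0], whose positivity is not assumed. *)
have -> : log2 (INR 0) = 0; last lra.
rewrite /log2 /ln /=; case: Rlt_dec => [h|_]; last lra.
by have := Rlt_irrefl _ h.
Qed.

Lemma Rpower_le_base2 x y : x <= y -> Rpower 2 x <= Rpower 2 y.
Proof. by move=> xy; apply: Rle_Rpower; lra. Qed.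

Lemma Rpower_sublinear kappa eta : kappa < 1 -> 0 < eta ->
  exists L0, 1 <= L0 /\ forall L, L0 <= L -> 2 * Rpower L kappa <= eta * L.
Proof.
move=> k1 eta0; have e2 : 0 < 2 / eta by apply: Rdiv_lt_0_compat; lra.
(* Beyond this point [L ^ (1 - kappa) >= 2 / eta]; multiplying by [eta * L ^ kappa] gives the
   claim. *)
exists (Rmax 1 (Rpower (2 / eta) (/ (1 - kappa)))); split; first exact: Rmax_l.
move=> L hL.
have L1 : 1 <= L by apply: Rle_trans (Rmax_l _ _) hL.
have h : 2 / eta <= Rpower L (1 - kappa).
  have -> : 2 / eta = Rpower (Rpower (2 / eta) (/ (1 - kappa))) (1 - kappa).
    by rewrite Rpower_mult Rinv_l ?Rpower_1 //; lra.
  apply: Rle_Rpower_l; first lra.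
  by split; [exact: exp_pos | apply: Rle_trans (Rmax_r _ _) hL].
have -> : eta * L = eta * Rpower L (1 - kappa) * Rpower L kappa.
  rewrite Rmult_assoc -Rpower_plus; have -> : 1 - kappa + kappa = 1 by ring.
  by rewrite Rpower_1; lra.
apply: Rmult_le_compat_r; first exact/Rlt_le/exp_pos.
have : eta * (2 / eta) <= eta * Rpower L (1 - kappa) by apply: Rmult_le_compat_l; lra.
by have -> : eta * (2 / eta) = 2 by field; lra.
Qed.

Lemma exists_INR_ge x : exists n : nat, x <= INR n.
Proof.
have [h _] := archimed x; exists (Z.abs_nat (up x)).
rewrite INR_IZR_INZ Zabs2Nat.id_abs; apply: Rle_trans (Rlt_le _ _ h) _.
apply: IZR_le; lia.
Qed.

Lemma log2_eventually_ge (an : nat -> nat) eps n0 L0 : 0 < eps ->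
  (forall n, (n0 <= n)%N -> Rpower (INR n) (1 + eps) <= INR (an n)) ->
  exists n1, forall n, (n1 <= n)%N -> L0 <= log2 (INR (an n)).
Proof.
move=> eps0 han; have [m hm] := exists_INR_ge (Rmax 1 (Rpower 2 L0)).
exists (maxn n0 m) => n; rewrite geq_max => /andP [hn0 hnm].
have hmn : INR m <= INR n by apply: le_INR; lia.
have n1 : 1 <= INR n by have := Rmax_l 1 (Rpower 2 L0); lra.
have h2 : L0 <= log2 (INR n).
  rewrite -{1}(log2_Rpower2 L0); apply: log2_le; first exact: exp_pos.
  by have := Rmax_r 1 (Rpower 2 L0); lra.
apply: Rle_trans (log2_le _ _ _ (han n hn0)); last exact: exp_pos.
by rewrite log2_Rpower; have := log2_INR_ge0 n; nra.
Qed.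

(** With [2 ^ L] in the role of [a_n], the quotient is at most [2 ^ (2 * L ^ kappa - L)], hence at
    most [2 ^ (- (1 - eta) * L)]. A share [eta * L] of the exponent is kept as decay in [a_n]; the
    remaining [(1 - 2 * eta) * L] is traded for a summable power of [n]. *)
Lemma term_bound L kappa eta eps s n a b :
  2 * Rpower L kappa <= eta * L ->
  (1 + eps) * (1 - 2 * eta) = 1 + s -> 0 < 1 - 2 * eta -> 1 <= n ->
  Rpower n (1 + eps) <= Rpower 2 L ->
  Rabs b <= Rpower 2 (Rpower L kappa) ->
  Rpower 2 L * Rpower 2 (- Rpower L kappa) <= Rabs a ->
  Rabs (b / a) <= Rpower 2 (- (eta * L)) * Rpower n (- (1 + s)).
Proof.
move=> hL hs heta n1 hn hb ha.
have a0 : 0 < Rabs a.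
  by apply: Rlt_le_trans ha; apply: Rmult_lt_0_compat; exact: exp_pos.
have h1 : Rabs (b / a) <= Rpower 2 (- ((1 - eta) * L)).
  apply: (Rmult_le_reg_r (Rabs a)) => //.
  rewrite /Rdiv Rabs_mult Rabs_inv Rmult_assoc Rinv_l ?Rmult_1_r; last lra.
  apply: Rle_trans hb _.
  apply: Rle_trans (Rmult_le_compat_l _ _ _ (Rlt_le _ _ (exp_pos _)) ha).
  rewrite -!Rpower_plus; apply: Rpower_le_base2; lra.
apply: Rle_trans h1 _.
have -> : - ((1 - eta) * L) = - (eta * L) + - (L * (1 - 2 * eta)) by ring.
rewrite Rpower_plus; apply: Rmult_le_compat_l; first exact/Rlt_le/exp_pos.
rewrite !Rpower_Ropp -hs -Rpower_mult -(Rpower_mult n).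
apply: Rinv_le_contravar; first exact: exp_pos.
apply: Rle_Rpower_l; first lra.
by split=> //; exact: exp_pos.
Qed.

(** The hypotheses give [T n.+1 + 1 <= (1 + 2 * D) * (T n + 1) + A ^ n.+1], so [T] grows at most
    geometrically. In the ratio [B = b + A + A0], [b] covers [1 + 2 * D], [A] covers the
    inhomogeneous term, and [A0] makes [B] admissible in the limsup hypothesis. *)
Lemma recurrence_growth (L T : nat -> R) (A A0 : nat) (D : R) (N : nat) :
  0 <= D -> (0 < A)%N ->
  (forall n, T n.+1 = T n + (2 * L n.+1 + INR (A ^ n.+1)%N)) ->
  (forall n, (N <= n)%N -> L n.+1 <= D * (T n + 1)) ->
  exists (B : nat) (C : R), (A0 <= B)%N /\ (0 < B)%N /\
    forall n, (N < n)%N -> L n <= C * INR (B ^ n)%N.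
Proof.
move=> D0 A1 hT hL; have [b hb] := exists_INR_ge (1 + 2 * D).
pose B := (b + A + A0)%N; pose C := Rmax 1 (T N + 1).
have C1 : 1 <= C by exact: Rmax_l.
have B1 : (0 < B)%N by rewrite /B; lia.
have Bpow n : 1 <= INR (B ^ n)%N.
  by rewrite -[X in X <= _]/(INR 1); apply: le_INR; apply/ssrnat.leP; rewrite expn_gt0 B1.
have mulINR m n : INR (m * n)%N = INR m * INR n by exact: mult_INR.
have hU n : (N <= n)%N -> T n + 1 <= C * INR (B ^ n)%N.
  elim: n => [|n IHn].
    by rewrite leqn0 => /eqP N0; rewrite expn0 Rmult_1_r /C N0; exact: Rmax_r.
  rewrite leq_eqVlt => /orP [/eqP <-|hn].
    by have := Bpow N; have := Rmax_r 1 (T N + 1); rewrite -/C; nra.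
  have {}IHn := IHn hn; have {}hL := hL n hn; rewrite hT.
  have hA : INR (A ^ n.+1)%N <= INR A * INR (B ^ n)%N.
    rewrite -mulINR; apply: le_INR; apply/ssrnat.leP; rewrite expnS leq_mul2l.
    by apply/orP; right; elim: n {IHn hL hn} => // n IH; rewrite !expnS leq_mul // /B; lia.
  have hB : INR (B ^ n.+1)%N = (INR b + INR A + INR A0) * INR (B ^ n)%N.
    by rewrite expnS mulINR /B !plus_INR.
  have := Bpow n; rewrite hB; move: (INR (B ^ n)%N) IHn hA => Y IHn hA Y1.
  have A0p := pos_INR A; have A0p' := pos_INR A0.
  have h1 : (1 + 2 * D) * (T n + 1) <= (1 + 2 * D) * (C * Y).
    by apply: Rmult_le_compat_l; lra.
  have h2 : 0 <= (INR b - (1 + 2 * D)) * (C * Y).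
    by apply: Rmult_le_pos; [lra | nra].
  have AY : 0 <= INR A * Y by apply: Rmult_le_pos; lra.
  have h3 : INR A * Y <= INR A * Y * C by nra.
  have h4 : 0 <= INR A0 * Y * C by apply: Rmult_le_pos; [apply: Rmult_le_pos; lra | lra].
  nra.
exists B, (D * C); split; first by rewrite /B; lia.
split=> // -[//|n] hn; apply: Rle_trans (hL n hn) _; rewrite Rmult_assoc.
apply: Rmult_le_compat_l => //; apply: Rle_trans (hU n hn) _.
apply: Rmult_le_compat_l; first lra.
by apply: le_INR; apply/ssrnat.leP; rewrite leq_pexp2l.
Qed.

(** The exponential bound would cap the roots by [2 ^ C] from [N.+1] on, while the limsup hypothesis
    supplies one of size at least [2 ^ (C + 1)]. *)
Lemma limsup_root_not_exponential (an : nat -> nat) (B N : nat) (C : R) :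
  (0 < B)%N -> (forall n, (N < n)%N -> (0 < an n)%N) ->
  (forall (M : R) (N0 : nat), exists n, (N0 <= n)%N /\
     M <= Rpower (INR (an n)) (/ INR (B ^ n)%N)) ->
  ~ (forall n, (N < n)%N -> log2 (INR (an n)) <= C * INR (B ^ n)%N).
Proof.
move=> B0 an0 hlim hC; have [n [hn]] := hlim (Rpower 2 (C + 1)) N.+1.
have Bn : 0 < INR (B ^ n)%N by apply: lt_0_INR; apply/ssrnat.ltP; rewrite expn_gt0 B0.
move=> /(log2_le _ _ (exp_pos _)); rewrite log2_Rpower2 log2_Rpower => h.
have := hC n hn.
have : (C + 1) * INR (B ^ n)%N <= / INR (B ^ n)%N * log2 (INR (an n)) * INR (B ^ n)%N.
  by apply: Rmult_le_compat_r; lra.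
have -> : / INR (B ^ n)%N * log2 (INR (an n)) * INR (B ^ n)%N = log2 (INR (an n)).
  by field; lra.
lra.
Qed.

(** Only the factors beyond [n0] are controlled; the constant [q n0 * Rpower 2 (- T n0)] absorbs the
    earlier ones. *)
Lemma prod_growth_bound (q w T : nat -> R) n0 N :
  (forall n, q n.+1 = q n * w n.+1) -> (forall n, 0 <= q n) ->
  (forall n, (n0 <= n)%N -> w n.+1 <= Rpower 2 (T n.+1 - T n)) ->
  (n0 <= N)%N -> q N <= q n0 * Rpower 2 (- T n0) * Rpower 2 (T N).
Proof.
move=> hq q0 hw; elim: N => [|N IHN].
  rewrite leqn0 => /eqP ->; rewrite Rmult_assoc -Rpower_plus Rplus_opp_l Rpower_O; lra.
rewrite leq_eqVlt => /orP [/eqP <-|hN].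
  rewrite Rmult_assoc -Rpower_plus Rplus_opp_l Rpower_O; lra.
rewrite hq.
have -> : Rpower 2 (T N.+1) = Rpower 2 (T N) * Rpower 2 (T N.+1 - T N).
  by rewrite -Rpower_plus; congr Rpower; ring.
rewrite -Rmult_assoc; apply: Rle_trans (Rmult_le_compat_l _ _ _ (q0 N) (hw N hN)) _.
by apply: Rmult_le_compat_r; [exact/Rlt_le/exp_pos | exact: IHN].
Qed.

Lemma eventually_forall_le (K : nat) (Q : nat -> nat -> Prop) :
  (forall k, (1 <= k <= K)%N -> exists n0, forall n, (n0 <= n)%N -> Q k n) ->
  exists n0, forall k n, (1 <= k <= K)%N -> (n0 <= n)%N -> Q k n.
Proof.
elim: K => [|K IHK] hQ; first by exists 0%N => k n; lia.
have [k hk|n0 hn0] := IHK; first by apply: hQ; lia.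
have [|n1 hn1] := hQ K.+1; first lia.
exists (maxn n0 n1) => k n /andP [k1]; rewrite leq_eqVlt geq_max => /orP [/eqP ->|hk] /andP [h0 h1].
  exact: hn1.
by apply: hn0 => //; lia.
Qed.

End Analysis.

(** * Consequences of an algebraic relation between the limits *)

Section AlgebraicRelation.
Local Open Scope ring_scope.

(** As [P] vanishes at [alpha], the Lipschitz bound gives [|P (x)| <= C * d], and the denominators
    bound [|P (x)|] from below. [Y] is the growing factor common to all denominators, and [G] holds
    the fixed ones. *)
Lemma algebraic_relation_bound (K : nat) (F : realFieldType) (P : {mpoly rat[K]})
    (alpha : 'I_K -> F) (d0 : F) :
  (map_mpoly (ratr : rat -> F) P).@[alpha] = 0 ->
  exists2 C : F, 0 < C & forall (x D : 'I_K -> rat) (d : F) (G : 'I_K -> F) (Y : F),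
    (forall i, D i \is a Num.int) -> (forall i, x i * D i \is a Num.int) ->
    (forall i, D i != 0) -> P.@[x] != 0 ->
    (forall i, `|ratr (x i) - alpha i| <= d) -> 0 <= d <= d0 ->
    (forall i, `|ratr (D i)| <= G i * Y) ->
    1 <= C * d * ((\prod_i G i ^+ msize P) * Y ^+ (msize P * K)).
Proof.
move=> Palpha.
have [c c0 hc] := meval_rat_lower_bound K P.
(* This radius puts [alpha] and all admissible [x] in one box, so [C] does not depend on [x]. *)
have [C C0 hC] := meval_lipschitz K F (map_mpoly ratr P) (\sum_i `|alpha i| + d0).
exists (C * ratr c) => [|x D d G Y Dint xDint D0 Px0 hx /andP [dge0 dle] hD].
  by rewrite mulr_gt0 ?ltr0q.
have halpha i : `|alpha i| <= \sum_i `|alpha i|.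
  by rewrite (bigD1 i) //= lerDl sumr_ge0.
have := hc x D Dint xDint D0 Px0.
rewrite -(ler_rat F) rmorph1 => /le_trans; apply.
rewrite !rmorphM /= rmorph_prod /= (mulrAC C).
rewrite -(mulrA (C * d)) ler_pM //.
- by rewrite ler0q normr_ge0.
- by rewrite mulr_ge0 ?ler0q ?(ltW c0) // prodr_ge0 // => i _; rewrite ler0q exprn_ge0.
- rewrite ratr_norm -meval_map_ratr -[X in `|X|]subr0 -Palpha.
  apply: hC => // i.
    rewrite -[ratr (x i)](subrK (alpha i)) addrC (le_trans (ler_normD _ _)) //.
    by rewrite lerD // (le_trans (hx i)).
  by rewrite (le_trans (halpha i)) // lerDl (le_trans dge0).
- rewrite ler_pM2l ?ltr0q //.
  rewrite exprM -[X in _ ^+ X]card_ord -prodr_const -big_split /=.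
  apply: ler_prod => i _; rewrite ler0q exprn_ge0 // rmorphXn /= ratr_norm -exprMn.
  by rewrite lerXn2r ?nnegrE ?normr_ge0 // (le_trans _ (hD i)).
Qed.

Lemma int_partial_sum_mul_denominators (a b : nat -> Z) (N : nat) :
  (forall n, (1 <= n)%N -> a n <> Z0) ->
  [/\ \prod_(1 <= n < N.+1) ratZ (a n) \is a Num.int,
      \prod_(1 <= n < N.+1) ratZ (a n) != 0 &
      (\sum_(1 <= n < N.+1) ratZ (b n) / ratZ (a n)) *
        \prod_(1 <= n < N.+1) ratZ (a n) \is a Num.int].
Proof.
move=> a0; elim: N => [|N [Dint D0 xDint]]; first by rewrite !big_geq.
have aN0 : ratZ (a N.+1) != 0 by rewrite intr_eq0; have := a0 N.+1 isT; lia.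
rewrite !(big_nat_recr N.+1) //=; split.
- by rewrite rpredM ?intr_int.
- by rewrite mulf_neq0.
- rewrite mulrDl rpredD //; first by rewrite mulrA rpredM ?intr_int.
  by rewrite (mulrC (\prod_(_ <= _ < _) _)) mulrA divfK // rpredM ?intr_int.
Qed.

Lemma IZR_ratr z : IZR z = ratr (ratZ z) :> R.
Proof.
rewrite /ratZ ratr_int; case: z => [|q|q] //.
  rewrite IZRposE INRE -Pos_to_natE.
  by have -> : int_of_Z (Z.pos q) = (Pos.to_nat q)%:Z by lia.
rewrite -Pos2Z.opp_pos opp_IZR IZRposE INRE RoppE -Pos_to_natE.
have -> : int_of_Z (- Z.pos q) = - (Pos.to_nat q)%:Z by lia.
by rewrite rmorphN.
Qed.

Lemma sum_f_R0_ratr (a b : nat -> Z) (N : nat) :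
  sum_f_R0 (fun n => Rdiv (IZR (b n.+1)) (IZR (a n.+1))) N =
  ratr (\sum_(1 <= n < N.+2) ratZ (b n) / ratZ (a n)).
Proof.
elim: N => [|N IHN] /=.
  rewrite big_nat1 rmorphM /= fmorphV /= -!IZR_ratr.
  by rewrite RdivE.
by rewrite (big_nat_recr N.+2) //= rmorphD rmorphM /= fmorphV /= -!IZR_ratr -IHN -RdivE.
Qed.

Lemma partial_sums_not_root (K p : nat) (a b : nat -> nat -> Z) (P : {mpoly rat[K]}) :
  prime p ->
  (forall k n, (1 <= k <= K)%N -> (1 <= n)%N -> a k n <> Z0 /\ b k n <> Z0 /\
     ~ Z.divide (Z.of_nat p) (Z.gcd (a k n) (b k n))) ->
  (forall k, (1 <= k <= K)%N -> exists N0, forall N, (N0 <= N)%N ->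
     exists! n, (1 <= n <= N)%N /\ nu p (a k n) = maxnu p (a k) N) ->
  (forall k, (1 <= k <= K)%N -> forall M : R, exists N0, forall N, (N0 <= N)%N ->
     Rle M (Rdiv (INR (maxnu p (a k) N)) (Rplus 1 (INR (maxnu p (a k.-1) N))))) ->
  P != 0 -> exists N0, forall N, (N0 <= N)%N ->
    P.@[fun i : 'I_K => \sum_(1 <= n < N.+1) ratZ (b i.+1 n) / ratZ (a i.+1 n)] != 0.
Proof.
move=> pp hab huniq hlim P0.
have [M hM] := meval_neq0_of_pval K p P pp P0.
have [N1 hN1] := eventually_forall_le K _ huniq.
(* The factor [M.+1] is positive even when [M] is 0, which makes all the maxima positive, as
   [pval_eq_partial_sum] demands. *)
have [N2 hN2] := eventually_forall_le K _ (fun k hk => hlim k hk (INR M.+1)).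
exists (maxn N1 N2) => N; rewrite geq_max => /andP [h1 h2].
have gap k : (k < K)%N -> (M.+1 * (1 + maxnu p (a k) N) <= maxnu p (a k.+1) N)%N.
  move=> kK; apply/ssrnat.leP/INR_le; rewrite mult_INR plus_INR.
  have V0 := pos_INR (maxnu p (a k) N); have := hN2 k.+1 N kK h2; rewrite [_.-1]/= => h.
  apply: (Rle_trans _ _ _ (Rmult_le_compat_r _ _ _ _ h)).
    by apply: Rplus_le_le_0_compat => //; exact: Rle_0_1.
  apply: Req_le; rewrite /Rdiv Rmult_assoc Rinv_l ?Rmult_1_r //.
  by apply/Rgt_not_eq/Rlt_gt/Rplus_lt_le_0_compat => //; exact: Rlt_0_1.
apply: (hM (fun k => maxnu p (a k) N)) => [k kK|i].
  by apply: leq_trans (gap k kK); rewrite leq_mul2r leqnSn orbT.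
have iK : (1 <= i.+1 <= K)%N by exact: ltn_ord.
apply: pval_eq_partial_sum => //.
- by move=> n n1; apply: hab.
- by apply: hN1.
- by apply: leq_trans (gap i (ltn_ord i)); rewrite muln_gt0.
Qed.

End AlgebraicRelation.

(** * Combination of the arithmetic and analytic estimates *)

Open Scope R_scope.

Theorem theorem2 (K p : nat) (eps kappa : R) (a b : nat -> nat -> Z)
  (an : nat -> nat) (A0 : nat) :
  (0 < K)%N -> prime p ->
  (0 < eps) -> (0 < kappa) -> (kappa < 1) ->
  (forall k n, (1 <= k <= K)%N -> (1 <= n)%N ->
     a k n <> Z0 /\ b k n <> Z0 /\
     ~ (Z.divide (Z.of_nat p) (Z.gcd (a k n) (b k n)))) ->
  (forall n, a 0%N n = (Zpos xH)) ->
  (forall k, (1 <= k <= K)%N -> exists N0, forall N, (N0 <= N)%N ->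
     exists! n, (1 <= n <= N)%N /\ nu p (a k n) = maxnu p (a k) N) ->
  (forall k, (1 <= k <= K)%N -> forall M : R, exists N0, forall N, (N0 <= N)%N ->
     (M <= INR (maxnu p (a k) N) / (1 + INR (maxnu p (a k.-1) N)))) ->
  (forall n, (1 <= n)%N -> (0 < an n)%N) ->
  (forall n, (1 <= n)%N -> (an n <= an n.+1)%N) ->
  (forall k, (1 <= k <= K)%N -> forall A : nat, (A0 <= A)%N -> (0 < A)%N ->
     exists n0, forall n, (n0 <= n)%N ->
       (Rpower (INR n) (1 + eps) <= INR (an n)) /\ (an n <= an n.+1)%N /\
       (IZR (Z.abs (b k n)) <= Rpower 2 (Rpower (log2 (INR (an n))) kappa)) /\
       (INR (an n) * Rpower 2 (- Rpower (log2 (INR (an n))) kappa)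
          <= IZR (Z.abs (a k n))) /\
       (IZR (Z.abs (a k n)) <=
          Rmax (INR (an n) * Rpower 2 (Rpower (log2 (INR (an n))) kappa))
               (2 ^ (A ^ n)%N))) ->
  (forall A : nat, (A0 <= A)%N -> (0 < A)%N ->
     forall (M : R) (N0 : nat), exists n, (N0 <= n)%N /\
       (M <= Rpower (INR (an n)) (/ INR (A ^ n)%N))) ->
  exists alpha : 'I_K -> R,
    (forall i : 'I_K,
       infinite_sum (fun n => (IZR (b i.+1 n.+1) / IZR (a i.+1 n.+1))) (alpha i))
    /\ alg_indep alpha.
Proof.
move=> K0 pp eps0 _ kappa1 hab _ huniq hlim an0 anmono hbd hlimsup.
pose A := A0.+1; pose L n := log2 (INR (an n)).
have [n0 hn0] := eventually_forall_le K _
  (fun k hk => hbd k hk A (leqnSn A0) (ltn0Sn A0)).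
(* [eta] is chosen so that [(1 + eps) * (1 - 2 * eta) = 1 + s]: half of [eps] pays for the decay in
   [a_n], the other half for summability. *)
pose s := eps / 2; pose eta := eps / (4 * (1 + eps)).
have s0 : 0 < s by rewrite /s; lra.
have eta0 : 0 < eta by apply: Rdiv_lt_0_compat; lra.
have etas : (1 + eps) * (1 - 2 * eta) = 1 + s by rewrite /eta /s; field; lra.
have eta1 : 0 < 1 - 2 * eta by nra.
have [L0 [L01 hL0]] := Rpower_sublinear kappa eta kappa1 eta0.
have [n1 hn1] := log2_eventually_ge an eps n0 L0 eps0
  (fun n hn => proj1 (hn0 1%N n K0 hn)).
pose n2 := maxn (maxn n0 n1) 2.
have n2P n : (n2 <= n)%N -> [/\ (n0 <= n)%N, (n1 <= n)%N & (2 <= n)%N].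
  by rewrite /n2 !geq_max => /andP [/andP [-> ->] ->].
have anE n : (1 <= n)%N -> Rpower 2 (L n) = INR (an n).
  by move=> /an0 h; apply: Rpower2_log2; apply: lt_0_INR; lia.
have Lmono m n : (1 <= m)%N -> (m <= n)%N -> L m <= L n.
  move=> m1 mn; apply: log2_le; first by have := an0 m m1 => h; apply: lt_0_INR; lia.
  apply: le_INR; apply/ssrnat.leP; elim: n mn => [|n IHn]; first by lia.
  rewrite leq_eqVlt => /orP [/eqP -> //|mn].
  by apply: leq_trans (IHn mn) (anmono n _); lia.
(* Monotonicity of [L] replaces [L n] by [L N], so one factor serves the whole tail. *)
have hterm k n N : (1 <= k <= K)%N -> (n2 <= n)%N -> (1 <= N <= n)%N ->
    Rabs (IZR (b k n) / IZR (a k n)) <=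
    Rpower 2 (- (eta * L N)) * Rpower (INR n) (- (1 + s)).
  move=> hk hn /andP [N1 Nn]; have [h0 h1 h2] := n2P n hn.
  have [e1 [_ [e2 [e3 _]]]] := hn0 k n hk h0.
  have nge1 : 1 <= INR n by rewrite -[X in X <= _]/(INR 1); apply: le_INR; lia.
  rewrite -/(L n) in e2 e3; rewrite -anE in e1 e3; try lia.
  rewrite !abs_IZR in e2 e3.
  apply: Rle_trans (term_bound _ _ _ _ _ _ _ _ (hL0 _ (hn1 n h1)) etas eta1 nge1 e1 e2 e3) _.
  apply: Rmult_le_compat_r; first exact/Rlt_le/exp_pos.
  apply: Rpower_le_base2; have := Lmono N n N1 Nn; rewrite -/(L n); nra.
(* Telescoping majorant for the series of [E * n ^ (- (1 + s))]. *)
pose g E n := E / s * Rpower (INR n) (- s).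
have hg k n N : (1 <= k <= K)%N -> (n2 <= n)%N -> (1 <= N <= n.+1)%N ->
    let E := Rpower 2 (- (eta * L N)) in
    Rabs (IZR (b k n.+1) / IZR (a k n.+1)) <= g E n - g E n.+1.
  move=> hk hn hN E; apply: Rle_trans (hterm k n.+1 N hk _ hN) _; first lia.
  have [_ _ h2] := n2P n hn.
  have n1' : 1 < INR n.+1 by rewrite -[X in X < _]/(INR 1); apply: lt_INR; lia.
  have := Rpower_telescope s (INR n.+1) s0 n1'.
  have -> : INR n.+1 - 1 = INR n by rewrite S_INR; ring.
  rewrite /g -/E => h.
  have -> : E / s * Rpower (INR n) (- s) - E / s * Rpower (INR n.+1) (- s) =
    E / s * (Rpower (INR n) (- s) - Rpower (INR n.+1) (- s)) by ring.
  have -> : E * Rpower (INR n.+1) (- (1 + s)) =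
    E / s * (s * Rpower (INR n.+1) (- (1 + s))) by field; lra.
  apply: Rmult_le_compat_l => //.
  by apply/Rlt_le/Rdiv_lt_0_compat => //; exact: exp_pos.
have g0 N n : 0 <= g (Rpower 2 (- (eta * L N))) n.
  apply: Rmult_le_pos; last exact/Rlt_le/exp_pos.
  by apply/Rlt_le/Rdiv_lt_0_compat => //; exact: exp_pos.
have iK (i : 'I_K) : (1 <= i.+1 <= K)%N by exact: ltn_ord.
pose u k n := IZR (b k n.+1) / IZR (a k n.+1).
have hsum (i : 'I_K) : {l | infinite_sum (u i.+1) l}.
  apply: (infinite_sum_of_telescoping _ (g (Rpower 2 (- (eta * L n2)))) n2) => // n hn.
  apply: hg => //; first exact: ltnW.
  by have [_ _ h2] := n2P n2 (leqnn _); lia.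
pose alpha i := proj1_sig (hsum i).
have halpha (i : 'I_K) : infinite_sum (u i.+1) (alpha i) := proj2_sig (hsum i).
exists alpha; split=> // P P0 Palpha.
pose x N (i : 'I_K) := (\sum_(1 <= n < N.+1) ratZ (b i.+1 n) / ratZ (a i.+1 n))%R.
pose Dn N (i : 'I_K) := (\prod_(1 <= n < N.+1) ratZ (a i.+1 n))%R.
have tail N i : (n2 < N)%N ->
    Rabs (ratr (x N i) - alpha i) <= Rpower 2 (- (eta * L N.+1)) / s.
  (* [sum_f_R0] counts from 0, so its sum up to [N] is [x N.+1], and the first omitted term has
     original index [N.+2]. *)
  case: N => [//|N] hN; rewrite /x -sum_f_R0_ratr.
  apply: Rle_trans (infinite_sum_tail_bound _
    (g (Rpower 2 (- (eta * L N.+2)))) N _ (halpha i) _ _) _.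
  - by move=> n hn; apply: hg => //; lia.
  - by [].
  rewrite /g -[X in _ <= X]Rmult_1_r; apply: Rmult_le_compat_l.
    by apply/Rlt_le/Rdiv_lt_0_compat => //; exact: exp_pos.
  have N1 : 1 <= INR N.+1 by rewrite -[X in X <= _]/(INR 1); apply: le_INR; lia.
  by rewrite -(Rpower_O (INR N.+1)); [apply: Rle_Rpower; lra | lra].
(* Up to a constant, [2 ^ T N] bounds the product of the first [N] denominators of each series. *)
pose T := sum_f_R0 (fun n => 2 * L n + INR (A ^ n)%N).
have hT n : T n.+1 = T n + (2 * L n.+1 + INR (A ^ n.+1)%N) by [].
have T0 n : 0 <= T n.
  apply: cond_pos_sum => m; rewrite /L.
  by have := log2_INR_ge0 (an m); have := pos_INR (A ^ m)%N; lra.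
have hup k n : (1 <= k <= K)%N -> (n2 <= n)%N ->
    Rabs (IZR (a k n)) <= Rpower 2 (2 * L n + INR (A ^ n)%N).
  move=> hk hn; have [h0 h1 h2] := n2P n hn.
  have [_ [_ [_ [_ e]]]] := hn0 k n hk h0.
  rewrite -/(L n) -anE in e; last lia.
  rewrite -abs_IZR; apply: Rle_trans e _.
  have Lbig := hn1 n h1; have := hL0 _ Lbig; rewrite -/(L n) in Lbig * => hk2.
  have Ap := pos_INR (A ^ n)%N.
  (* The first alternative is at most [2 ^ (2 * L n)], because [L ^ kappa <= L] for large [L]; the
     second is [2 ^ (A ^ n)]. *)
  apply: Rmax_lub.
    by rewrite -Rpower_plus; apply: Rpower_le_base2; rewrite -/(L n); nra.
  rewrite -Rpower_pow; last lra.
  by apply: Rpower_le_base2; lra.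
pose q i N := Rabs (ratr (Dn N i)).
have qS (i : 'I_K) N : q i N.+1 = q i N * Rabs (IZR (a i.+1 N.+1)).
  rewrite /q /Dn (big_nat_recr N.+1) //= rmorphM /= -Rabs_mult.
  by rewrite -IZR_ratr.
pose G i := q i n2 * Rpower 2 (- T n2).
have hG i N : (n2 <= N)%N -> q i N <= G i * Rpower 2 (T N).
  move=> hN; apply: (prod_growth_bound _ (fun n => Rabs (IZR (a i.+1 n))) T _ _ (qS i)) => //.
    by move=> n; exact: Rabs_pos.
  move=> n hn; apply: Rle_trans (hup i.+1 n.+1 (iK i) (leqW hn)) _.
  by apply: Rpower_le_base2; rewrite hT; lra.
have [C C0 hC] := algebraic_relation_bound K _ P alpha (/ s) Palpha.
have [N3 hN3] := partial_sums_not_root K p a b P pp hab huniq hlim P0.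
pose C' := C * / s * (\prod_(i < K) G i ^+ msize P)%R.
pose m := (msize P * K)%N.
have key N : (maxn n2.+1 N3 <= N)%N ->
    1 <= C' * Rpower 2 (- (eta * L N.+1) + INR m * T N).
  rewrite geq_max => /andP [hn2 hN].
  have d0 := exp_pos (- (eta * L N.+1) * ln 2).
  have is0 : 0 < / s by exact: Rinv_0_lt_compat.
  have h := hC (x N) (Dn N) (Rpower 2 (- (eta * L N.+1)) / s) G (Rpower 2 (T N)).
  have anz (i : 'I_K) n : (1 <= n)%N -> a i.+1 n <> Z0.
    by move=> n1'; have [] := hab i.+1 n (iK i) n1'.
  have /RleP : (1 <= C * (Rpower 2 (- (eta * L N.+1)) / s) *
      ((\prod_i G i ^+ msize P) * Rpower 2 (T N) ^+ (msize P * K)))%R.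
    apply: h.
    - by move=> i; have [] := int_partial_sum_mul_denominators (a i.+1) (b i.+1) N (anz i).
    - by move=> i; have [] := int_partial_sum_mul_denominators (a i.+1) (b i.+1) N (anz i).
    - by move=> i; have [] := int_partial_sum_mul_denominators (a i.+1) (b i.+1) N (anz i).
    - exact: hN3.
    - by move=> i; rewrite -RabsE; apply/RleP; apply: tail.
    - apply/andP; split; apply/RleP.
        by apply/Rlt_le/Rdiv_lt_0_compat.
      rewrite -[X in _ <= X]Rmult_1_l; apply: Rmult_le_compat_r; first lra.
      rewrite -(Rpower_O 2); last lra.
      apply: Rpower_le_base2; have := log2_INR_ge0 (an N.+1); rewrite -/(L N.+1); nra.
    - by move=> i; rewrite -RabsE; apply/RleP; apply: hG; exact: ltnW.
  rewrite -RpowE -Rpower_pow; last exact: exp_pos.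
  rewrite Rpower_mult (Rmult_comm (T N)) Rpower_plus /C' -/m => {}h.
  apply: Rle_trans h _; apply: Req_le.
  rewrite -!RmultE -RinvE; move: (\prod_i _)%R => Q; ring.
(* Read off from [key]: a positive multiple of [C'] is at least 1. *)
have C'0 : 0 < C'.
  have := key _ (leqnn _); set N := maxn _ _.
  by have := exp_pos ((- (eta * L N.+1) + INR m * T N) * ln 2); rewrite -/(Rpower _ _); nra.
(* Logarithms in [key] give [eta * L N.+1 <= log2 C' + m * T N], and the right side is at most
   [(|log2 C'| + m) * (T N + 1)]. *)
pose D := (Rabs (log2 C') + INR m) / eta.
have D0 : 0 <= D.
  apply: Rmult_le_pos; last exact/Rlt_le/Rinv_0_lt_compat.
  by have := Rabs_pos (log2 C'); have := pos_INR m; lra.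
have hrec N : (maxn n2.+1 N3 <= N)%N -> L N.+1 <= D * (T N + 1).
  move=> /key; rewrite -{1}(Rpower2_log2 C') // -Rpower_plus.
  move=> /(log2_le _ _ Rlt_0_1); rewrite log2_Rpower2 {1}/log2 ln_1 => h.
  apply: (Rmult_le_reg_l eta) => //.
  have -> : eta * (D * (T N + 1)) = (Rabs (log2 C') + INR m) * (T N + 1).
    by rewrite /D; field; lra.
  have := Rle_abs (log2 C'); have := Rabs_pos (log2 C'); have := T0 N.
  have := pos_INR m; nra.
have [B [C1 [AB [B0 hB]]]] :=
  recurrence_growth L T A A0 D _ D0 (ltn0Sn A0) hT hrec.
apply: limsup_root_not_exponential B0 _ (hlimsup B AB B0) hB => n hn.
by apply: an0; lia.
Qed.
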